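(* For every positive integer $n$ and every edge $e$ of the complete graph $K_{2n+1}$, $w_{def}(K_{2n+1}-e)=3n-1$.
   Context: All graphs are finite, undirected, without loops or multiple edges. A proper $t$-edge-coloring of $G$ is a map $\alpha:E(G)\to\{1,\ldots,t\}$ such that all $t$ colors are used and adjacent edges receive different colors. The spectrum $S(v,\alpha)$ of a vertex $v$ is the set of colors on edges incident to $v$. For a finite set $A$ of integers, $def(A)=\max A-\min A-|A|+1$. Define $def(v,\alpha)=def(S(v,\alpha))$, $def(G,\alpha)=\sum_{v\in V(G)}def(v,\alpha)$, and $def(G)=\min_\alpha def(G,\alpha)$ over all proper edge-colorings $\alpha$ of $G$. $w_{def}(G)$ is the smallest $t$ such that $G$ has a proper $t$-edge-coloring $\alpha$ with $def(G,\alpha)=def(G)$. $K_{2n+1}-e$ denotes the complete graph on $2n+1$ vertices with one edge removed. *)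

(* Defs.v *)
From HB Require Import structures.
From mathcomp Require Import all_boot finmap boolp.

Set Implicit Arguments.
Unset Strict Implicit.
Unset Printing Implicit Defensive.

Local Open Scope fset_scope.

(* A finite simple graph on V, given by its edges, which are 2-element sets of
   vertices: this rules out loops and multiple edges. *)
Record sgraph (V : finType) := SGraph {
  edges : {set {set V}};
  edges_card2 : [forall e in edges, #|e| == 2]
}.

Lemma complete_card2 (V : finType) :
  [forall e in [set e : {set V} | #|e| == 2], #|e| == 2].
Proof. by apply/forall_inP => e; rewrite inE. Qed.

Definition complete_graph (V : finType) : sgraph V := SGraph (complete_card2 V).

Lemma del_edge_card2 (V : finType) (G : sgraph V) (e : {set V}) :
  [forall f in edges G :\ e, #|f| == 2].
Proof.
apply/forall_inP => f /setD1P[_].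
by move/forall_inP: (edges_card2 G); apply.
Qed.

Definition del_edge (V : finType) (G : sgraph V) (e : {set V}) : sgraph V :=
  SGraph (del_edge_card2 G e).

(* A coloring is a total function on vertex sets; only its values on the edges
   of G play a role here and below. *)
Definition proper_edge_coloring (V : finType) (G : sgraph V) (t : nat)
    (alpha : {set V} -> nat) : Prop :=
  [/\ forall e, e \in edges G -> 1 <= alpha e <= t,
      forall c, 1 <= c <= t -> exists2 e, e \in edges G & alpha e = c
    & forall e f, e \in edges G -> f \in edges G -> e != f ->
        ~~ [disjoint e & f] -> alpha e != alpha f].

Definition spectrum (V : finType) (G : sgraph V) (alpha : {set V} -> nat)
    (v : V) : {fset nat} :=
  [fset alpha e | e in [set e in edges G | v \in e]].

Definition fset_max (A : {fset nat}) : nat := \max_(a <- A) a.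

(* Starting the iteration at the maximum gives the least element of any
   nonempty A. *)
Definition fset_min (A : {fset nat}) : nat := \big[minn/fset_max A]_(a <- A) a.

(* max A - min A - |A| + 1, with the 1 added before |A| is subtracted so that
   truncated subtraction is exact when A is nonempty. The empty set (the
   spectrum of an isolated vertex) has deficiency 0. *)
Definition set_def (A : {fset nat}) : nat :=
  if A == fset0 then 0 else (fset_max A - fset_min A).+1 - #|` A|.

Definition coloring_def (V : finType) (G : sgraph V) (alpha : {set V} -> nat)
    : nat :=
  \sum_(v : V) set_def (spectrum G alpha v).

Lemma exists_proper_edge_coloring (V : finType) (G : sgraph V) :
  exists t alpha, proper_edge_coloring G t alpha.
Proof.
exists (size (enum (edges G))), (fun e => (index e (enum (edges G))).+1).
split=> [e eG|c /andP[c0 ct]|e f eG fG /eqP neq _].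
- by rewrite /= index_mem mem_enum.
- have lt : c.-1 < size (enum (edges G)) by rewrite prednK.
  exists (nth set0 (enum (edges G)) c.-1); first by rewrite -mem_enum mem_nth.
  by rewrite index_uniq ?enum_uniq // prednK.
- apply/eqP => -[eqi]; apply: neq.
  by rewrite -(nth_index set0 (_ : e \in enum (edges G))) ?mem_enum //
     eqi nth_index ?mem_enum.
Qed.

Definition attains_def (V : finType) (G : sgraph V) (d : nat) : bool :=
  `[< exists t alpha, proper_edge_coloring G t alpha /\
        coloring_def G alpha = d >].

Lemma exists_attains_def (V : finType) (G : sgraph V) :
  exists d, attains_def G d.
Proof.
have [t [alpha cG]] := exists_proper_edge_coloring G.
by exists (coloring_def G alpha); apply/asboolP; exists t, alpha.
Qed.

Definition graph_def (V : finType) (G : sgraph V) : nat :=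
  ex_minn (exists_attains_def G).

Definition has_optimal_coloring (V : finType) (G : sgraph V) (t : nat) : bool :=
  `[< exists alpha, proper_edge_coloring G t alpha /\
        coloring_def G alpha = graph_def G >].

Lemma exists_has_optimal_coloring (V : finType) (G : sgraph V) :
  exists t, has_optimal_coloring G t.
Proof.
rewrite /has_optimal_coloring /graph_def; case: ex_minnP => d /asboolP.
by case=> t [alpha cG] _; exists t; apply/asboolP; exists alpha.
Qed.

Definition w_def (V : finType) (G : sgraph V) : nat :=
  ex_minn (exists_has_optimal_coloring G).

(* Main.v *)
Require Import Defs.
From mathcomp Require Import all_boot all_fingroup finmap boolp zify.

(* Lower bounds: reduce the colours modulo 2n. If z_r vertices miss the residue
   r, then the sum of the z_r is at most def + 2: a missed residue at v comes from
   a gap of the spectrum of v, or from the degree 2n - 1 of an end of e. The number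
   2n + 1 of vertices is odd, hence the number N_r of edges whose colour has
   residue r satisfies N_r + z_r >= n + 1; summing over r gives def >= n - 1.
   Since a colour occurs on at most n edges, residue r carries at least 2 - z_r
   colours, so the number of colours is at least 4n - (def + 2).

   Upper bound: one vertex gets the spectrum [1, n] U [2n, 3n-1], of deficiency
   n - 1. The others split into two groups with spectra [1, 2n] and [n, 3n-1],
   one end of e in each group, lacking the last resp. the first of these colours.
   The edges inside the groups and to the exceptional vertex come from
   1-factorizations of complete graphs, the edges between the groups from a Latin
   square. *)

Set Implicit Arguments.
Unset Strict Implicit.
Unset Printing Implicit Defensive.

Local Open Scope nat_scope.

(** * Extremes, gaps and missed residues of finite sets of naturals *)

Lemma leq_fset_max (A : {fset nat}) a : a \in A -> a <= fset_max A.
Proof. by move=> aA; rewrite /fset_max; apply: leq_bigmax_seq. Qed.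

Lemma fset_max_leq (A : {fset nat}) m :
  (forall a, a \in A -> a <= m) -> fset_max A <= m.
Proof. by move=> Am; apply/bigmax_leqP_seq => a aA _; apply: Am. Qed.

Lemma leq_bigminP (s : seq nat) (m0 m : nat) :
  reflect (m <= m0 /\ forall a, a \in s -> m <= a)
          (m <= \big[minn/m0]_(a <- s) a).
Proof.
elim: s => [|b s IHs]; first by rewrite big_nil; apply: (iffP idP) => [|[]].
rewrite big_cons leq_min; apply: (iffP andP) => [[mb /IHs[mm0 ms]]|[mm0 ms]].
  by split=> // a; rewrite inE => /predU1P[->|/ms].
split; first by rewrite ms ?mem_head.
by apply/IHs; split=> // a a_s; rewrite ms // inE a_s orbT.
Qed.

Lemma fset_min_leq (A : {fset nat}) a : a \in A -> fset_min A <= a.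
Proof.
by move=> aA; have /leq_bigminP[_] := leqnn (fset_min A); apply.
Qed.

Lemma leq_fset_min (A : {fset nat}) m :
  A != fset0 -> (forall a, a \in A -> m <= a) -> m <= fset_min A.
Proof.
case/fset0Pn=> a0 a0A mA; apply/leq_bigminP; split=> //.
by apply: leq_trans (leq_fset_max a0A); apply: mA.
Qed.

Lemma set_def_leq (A : {fset nat}) (lo hi : nat) :
    A != fset0 -> (forall a, a \in A -> lo <= a <= hi) ->
  set_def A <= hi.+1 - lo - #|` A|.
Proof.
move=> A0 Alohi; rewrite /set_def (negPf A0).
have maxA : fset_max A <= hi by apply: fset_max_leq => a /Alohi/andP[].
have : lo <= fset_min A by apply: leq_fset_min => // a /Alohi/andP[].
have [a /[dup] /fset_min_leq aA /leq_fset_max] := fset0Pn _ A0.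
lia.
Qed.

(* The representatives of the missed residues in the window of length M that
   starts at the minimum of A are not in A. *)
Lemma missed_residues_leq (A : {fset nat}) (M : nat) :
    A != fset0 -> #|` A| <= M ->
  #|[set r : 'I_M | ~~ has (fun a => a %% M == r) A]| + #|` A| <= set_def A + M.
Proof.
move=> A0 AM; rewrite /set_def (negPf A0).
set lo := fset_min A; set L := (fset_max A - lo).+1.
have Awin a : a \in A -> a \in iota lo L.
  move=> /[dup] /fset_min_leq; rewrite -/lo => loa /leq_fset_max.
  rewrite mem_iota; lia.
have card_le K : L <= K -> count [predC A] (iota lo K) + #|` A| = K.
  move=> LK; rewrite -[RHS](size_iota lo K).
  rewrite -(count_predC (mem A) (iota lo K)) addnC.
  congr addn; rewrite -size_filter; apply/perm_size/uniq_perm.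
  - exact: fset_uniq.
  - by rewrite filter_uniq ?iota_uniq.
  move=> a; rewrite mem_filter; apply/idP/andP => [aA|[]//]; split=> //.
  by move: (Awin a aA); rewrite !mem_iota; lia.
suff missed : #|[set r : 'I_M | ~~ has (fun a => a %% M == r) A]| <=
    count [predC A] (iota lo M).
  (* The longer of the two windows contains [A], so its gaps are counted exactly by [card_le]. *)
  have le_max : count [predC A] (iota lo M) <=
      count [predC A] (iota lo (maxn L M)).
    apply: leq_count_subseq; rewrite -(subnKC (leq_maxr L M)) iotaD.
    exact: prefix_subseq.
  have [cM cL] := (card_le _ (leq_maxl L M), card_le _ (leqnn L)).
  move: cM cL le_max missed.
  by rewrite -/lo -/L; lia.
rewrite -size_filter cardE -(size_map val (enum _)).
rewrite -(size_map (modn^~ M) (filter _ _)).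
apply: uniq_leq_size; first by rewrite (map_inj_uniq val_inj) enum_uniq.
move=> _ /mapP[r + ->]; rewrite mem_enum inE => rA; apply/mapP.
have rM := ltn_ord r; have M0 : 0 < M by lia.
(* The summand [M * lo] leaves the residue unchanged and keeps the subtraction of [lo] from
   truncating. *)
exists (lo + (r + M * lo - lo) %% M).
  rewrite mem_filter mem_iota /= leq_addr ltn_add2l ltn_mod M0 !andbT.
  apply: contra rA => aA; apply/hasP.
  exists (lo + (r + M * lo - lo) %% M) => //.
  rewrite modnDmr subnKC ?modnMDl; last by nia.
  by rewrite addnC mulnC modnMDl modn_small.
rewrite modnDmr subnKC; last by nia.
by rewrite addnC mulnC modnMDl modn_small.
Qed.

(** * Counting edges and vertices by the residues of colours *)

Definition incident (V : finType) (G : sgraph V) (v : V) : {set {set V}} :=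
  [set f in edges G | v \in f].

Lemma handshake (V : finType) (G : sgraph V) (P : pred {set V}) :
  \sum_v #|[set f in incident G v | P f]| = 2 * #|[set f in edges G | P f]|.
Proof.
under eq_bigr => v _ do rewrite -sum1dep_card.
under eq_bigr => v _ do under eq_bigl => f do rewrite inE -andbA andbCA.
rewrite (exchange_big_dep (fun f => (f \in edges G) && P f)) /=; last first.
  by move=> v f _ /andP[].
rewrite -sum1dep_card big_distrr /=; apply: eq_bigr => f /andP[fG ->].
have /eqP f2 := forall_inP (edges_card2 G) f fG.
by rewrite fG muln1 -f2 -sum1_card; apply: eq_bigl => v; rewrite !andbT.
Qed.

Lemma proper_edge_coloring_inj (V : finType) (G : sgraph V) t alpha v :
  proper_edge_coloring G t alpha -> {in incident G v &, injective alpha}.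
Proof.
case=> _ _ proper f g; rewrite !inE => /andP[fG vf] /andP[gG vg] fg.
apply/eqP; apply: contraT => neq_fg; have := proper f g fG gG neq_fg.
rewrite fg eqxx; apply; apply/pred0Pn; exists v.
by rewrite /= vf.
Qed.

Lemma card_spectrum (V : finType) (G : sgraph V) t alpha v :
  proper_edge_coloring G t alpha ->
  #|` spectrum G alpha v| = #|incident G v|.
Proof.
move=> proper; rewrite /spectrum card_in_imfset /=; first by rewrite -cardE.
exact: proper_edge_coloring_inj proper.
Qed.

Lemma spectrum_neq0 (V : finType) (G : sgraph V) alpha v :
  0 < #|incident G v| -> spectrum G alpha v != fset0.
Proof.
case/card_gt0P=> f fv; apply/fset0Pn; exists (alpha f).
by apply/imfsetP; exists f.
Qed.

Lemma color_class_leq (V : finType) (G : sgraph V) t alpha c :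
  proper_edge_coloring G t alpha ->
  2 * #|[set f in edges G | alpha f == c]| <= #|V|.
Proof.
move=> proper; rewrite -handshake -sum1_card; apply: leq_sum => v _.
rewrite leqNgt; apply/card_gt1P => -[f [g []]]; rewrite !inE.
move=> /andP[fv /eqP fc] /andP[gv /eqP gc] /eqP; apply.
by apply: (proper_edge_coloring_inj proper (v := v)); rewrite ?inE // fc.
Qed.

Definition missing_residue (V : finType) (G : sgraph V) (alpha : {set V} -> nat)
    (M r : nat) : {set V} :=
  [set v | ~~ has (fun a => a %% M == r) (spectrum G alpha v)].

Definition residue_class (V : finType) (G : sgraph V) (alpha : {set V} -> nat)
    (M r : nat) : {set {set V}} :=
  [set f in edges G | alpha f %% M == r].

(** Sums [missed_residues_leq] over the vertices: spectrum sizes are degrees, which add up to twice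
    the number of edges. *)
Lemma sum_missing_residue_leq (V : finType) (G : sgraph V) t alpha M :
    proper_edge_coloring G t alpha ->
    (forall v, 0 < #|incident G v| <= M) ->
  \sum_(r < M) #|missing_residue G alpha M r| + 2 * #|edges G|
    <= coloring_def G alpha + #|V| * M.
Proof.
move=> proper degG.
have -> : 2 * #|edges G| = \sum_v #|incident G v|.
  have := handshake G predT; rewrite /= => E.
  have -> : #|edges G| = #|[set f in edges G | predT f]|.
    by apply: eq_card => f; rewrite inE andbT.
  by rewrite -E; apply: eq_bigr => v _; apply: eq_card => f; rewrite !inE andbT.
have -> : \sum_(r < M) #|missing_residue G alpha M r| =
    \sum_v #|[set r : 'I_M |
                ~~ has (fun a => a %% M == r) (spectrum G alpha v)]|.
  under eq_bigr => r _ do rewrite -sum1dep_card.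
  rewrite (exchange_big_dep xpredT) //=.
  by apply: eq_bigr => v _; rewrite sum1dep_card.
rewrite -big_split /=.
rewrite -sum_nat_const /coloring_def -big_split /=.
apply: leq_sum => v _; have /andP[v0 vM] := degG v.
rewrite -(card_spectrum v proper).
by apply: missed_residues_leq; rewrite ?spectrum_neq0 ?(card_spectrum v proper).
Qed.

(** A vertex that does not miss [r] lies on an edge of the class, and such an edge covers two
    vertices. *)
Lemma card_residue_class (V : finType) (G : sgraph V) alpha M r :
  #|V| <= #|missing_residue G alpha M r| + 2 * #|residue_class G alpha M r|.
Proof.
rewrite -handshake /missing_residue -sum1dep_card -sum1_card.
rewrite [in leqRHS]big_mkcond -big_split /=.
apply: leq_sum => v _; case: ifPn => //; rewrite negbK => /hasP[c /imfsetP[f]].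
rewrite /= inE => fv -> fr; rewrite add0n card_gt0; apply/set0Pn; exists f.
by rewrite !inE fr andbT in fv *.
Qed.

Lemma sum_residue_class (V : finType) (G : sgraph V) alpha M :
  0 < M -> \sum_(r < M) #|residue_class G alpha M r| = #|edges G|.
Proof.
move=> M0; under eq_bigr => r _ do rewrite -sum1dep_card.
rewrite (exchange_big_dep (mem (edges G))) /=; last by move=> r f _ /andP[].
rewrite -sum1_card; apply: eq_bigr => f fG.
rewrite (bigD1 (Ordinal (ltn_pmod (alpha f) M0))) /= ?fG ?eqxx // big1 //.
by move=> r /andP[/andP[_ /eqP fr]]; rewrite -val_eqE /= fr eqxx.
Qed.

(** Each colour class is a matching, so it has at most n edges on at most 2n + 1 vertices. *)
Lemma residue_class_leq (V : finType) (G : sgraph V) t alpha M r n :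
    #|V| <= 2 * n + 1 -> proper_edge_coloring G t alpha ->
  #|residue_class G alpha M r| <=
    n * count (fun c => c %% M == r) (iota 1 t).
Proof.
move=> Vn proper; rewrite -sum1_count big_distrr /=.
apply: (@leq_trans (\sum_(c <- iota 1 t | c %% M == r)
                     #|[set f in edges G | alpha f == c]|)); last first.
  by apply: leq_sum => c _; have := color_class_leq c proper; lia.
under eq_bigr => c _ do rewrite -sum1dep_card.
rewrite (exchange_big_dep (mem (edges G))) /=; last by move=> c f _ /andP[].
rewrite -sum1dep_card big_mkcondr /=; apply: leq_sum => f fG.
case: ifP => // fr.
case: proper => range _ _.
have ft : alpha f \in iota 1 t by rewrite mem_iota add1n ltnS range.
rewrite big_mkcond (bigD1_seq (alpha f)) ?iota_uniq //=.
by rewrite fr fG eqxx.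
Qed.

Lemma sum_count_residue M t :
  0 < M -> \sum_(r < M) count (fun c => c %% M == r) (iota 1 t) = t.
Proof.
move=> M0; under eq_bigr => r _ do rewrite -sum1_count.
rewrite (exchange_big_dep xpredT) //= -[RHS](size_iota 1 t) -sum1_size.
apply: eq_bigr => c _.
rewrite (bigD1 (Ordinal (ltn_pmod c M0))) //= big1 //.
by move=> r /andP[/eqP cr]; rewrite -val_eqE /= cr eqxx.
Qed.

(** * Lower bounds for the complete graph minus an edge *)

Lemma card_incident_del_edge (V : finType) (e : {set V}) v :
    e \in edges (complete_graph V) ->
  #|incident (del_edge (complete_graph V) e) v| = #|V|.-1 - (v \in e).
Proof.
move=> eK.
have -> : incident (del_edge (complete_graph V) e) v =
    [set [set v; u] | u in [set~ v]] :\ e.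
  apply/setP => f; rewrite !inE -andbA; case: eqP => //= _.
  apply/andP/imsetP => [[/cards2P[a [b [ab ->]]]]|[u]].
    rewrite !inE => /pred2P[] ->; first by exists b => //; rewrite !inE eq_sym.
    by exists a; rewrite ?inE // setUC.
  by rewrite !inE => uv ->; rewrite cards2 (eq_sym v) uv !inE eqxx.
have eE : (e \in [set [set v; u] | u in [set~ v]]) = (v \in e).
  apply/imsetP/idP => [[u _ ->]|]; first by rewrite !inE eqxx.
  move: eK; rewrite inE => /cards2P[a [b [ab ->]]].
  rewrite !inE => /pred2P[] ->; first by exists b => //; rewrite !inE eq_sym.
  by exists a; rewrite ?inE // setUC.
have <- : #|[set [set v; u] | u in [set~ v]]| = #|V|.-1.
  rewrite card_in_imset ?cardsC1 // => u w; rewrite !inE => uv wv /setP/(_ u).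
  by rewrite !inE eqxx orbT (negPf uv) => /esym/eqP.
by rewrite [in RHS](cardsD1 e) eE addKn.
Qed.

Lemma card_edges_del_edge (V : finType) (e : {set V}) n :
    #|V| = 2 * n + 1 -> e \in edges (complete_graph V) ->
  #|edges (del_edge (complete_graph V) e)| + 1 = 2 * n * n + n.
Proof.
move=> Vn eK; have := cardsD1 e (edges (complete_graph V)); rewrite eK /=.
rewrite card_draws Vn addn1 bin2odd /= ?mul2n ?odd_double ?doubleK //.
by move=> cardE; rewrite addnC -cardE mulSn addnC.
Qed.

Lemma coloring_def_del_edge_geq (V : finType) (e : {set V}) n t alpha :
    0 < n -> #|V| = 2 * n + 1 -> e \in edges (complete_graph V) ->
    proper_edge_coloring (del_edge (complete_graph V) e) t alpha ->
  n - 1 <= coloring_def (del_edge (complete_graph V) e) alpha /\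
  4 * n - 2 <= t + coloring_def (del_edge (complete_graph V) e) alpha.
Proof.
move=> n0 Vn eK; set G := del_edge _ _ => proper.
have M0 : 0 < 2 * n by lia.
have degG v : 0 < #|incident G v| <= 2 * n.
  by rewrite card_incident_del_edge // Vn; case: (v \in e); lia.
have EG := card_edges_del_edge Vn eK; rewrite -/G in EG.
have defG := sum_missing_residue_leq proper degG; rewrite Vn in defG.
(* From z + 2N >= 2n + 1 follows 2(z + N) >= 2n + 1, and parity rounds this up. *)
have class_geq r : n + 1 <= #|missing_residue G alpha (2 * n) r| +
    #|residue_class G alpha (2 * n) r|.
  by have := card_residue_class G alpha (2 * n) r; rewrite Vn; lia.
(* Without a colour of residue [r] all vertices miss it; with a single one, at most n edges leave at
   least one vertex out. *)
have colors_geq r : 2 <= #|missing_residue G alpha (2 * n) r| +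
    count (fun c => c %% (2 * n) == r) (iota 1 t).
  have := @residue_class_leq _ G t alpha (2 * n) r n _ proper.
  rewrite Vn leqnn => /(_ isT).
  have := card_residue_class G alpha (2 * n) r; rewrite Vn.
  by case: count => [|[|c]]; lia.
have := leq_sum (index_enum 'I_(2 * n)) (fun r (_ : xpredT r) => class_geq r).
have := leq_sum (index_enum 'I_(2 * n)) (fun r (_ : xpredT r) => colors_geq r).
rewrite !big_split /= sum_residue_class // sum_count_residue //.
rewrite !sum_nat_const card_ord.
move: EG defG; move: (coloring_def G alpha) #|edges G| => D E.
move: (\sum_(r < 2 * n) #|missing_residue G alpha (2 * n) r|) => S.
by move=> EG defG cols classes; split; nia.
Qed.

(** * Explicit colour matrices for odd and even n *)

Ltac split_ifs :=
  repeat match goal with |- context [if ?b then _ else _] =>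
    lazymatch b with context [if _ then _ else _] => fail | _ =>
    let H := fresh in case H : b end end.

Definition same_pair (x y u v : nat) : bool :=
  (u == x) && (v == y) || (u == y) && (v == x).

(* The colours of K_{2n+1} - xy are stored in a symmetric function on
   {0, .., 2n-1}: [core u u] is the colour of the edge joining u to the vertex
   2n. The vertices below p have spectrum [1, 2n], the other ones [n, 3n-1],
   except that x lacks the colour 2n and y the colour n. *)
Definition core_spec (n p x y : nat) (core : nat -> nat -> nat) : Prop :=
  [/\ forall u v, core u v = core v u,
      forall u v, u < 2 * n -> v < 2 * n -> ~~ same_pair x y u v ->
        (if u < p then 1 else n) + (u == y) <= core u v <
        (if u < p then 1 else n) + 2 * n - (u == x),
      forall u v w, u < 2 * n -> v < 2 * n -> w < 2 * n ->
        ~~ same_pair x y u v -> ~~ same_pair x y u w ->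
        core u v = core u w -> v = w
    & forall u v, u < 2 * n -> v < 2 * n -> core u u = core v v -> u = v].

Definition glue (p : nat) (rr rc cc : nat -> nat -> nat) (u v : nat) : nat :=
  if u < p then if v < p then rr u v else rc u (v - p)
  else if v < p then rc v (u - p) else cc (u - p) (v - p).

(** Splits [core_spec] by blocks, so that only linear arithmetic remains for the explicit
    matrices. *)
Lemma glue_spec (n p x y : nat) (rr rc cc : nat -> nat -> nat) :
    x < p -> p <= 2 * n ->
    (forall r s, rr r s = rr s r) -> (forall i j, cc i j = cc j i) ->
    (forall r s, r < p -> s < p -> 1 <= rr r s <= n) ->
    (forall r i, r < p -> p + i < 2 * n -> ~~ ((r == x) && (i == y)) ->
       n + (i == y) <= rc r i <= 2 * n - (r == x)) ->
    (forall i j, p + i < 2 * n -> p + j < 2 * n ->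
       n + (i == y) <= cc i j < 3 * n) ->
    (forall r s s', r < p -> s < p -> s' < p -> rr r s = rr r s' -> s = s') ->
    (forall r i i', r < p -> p + i < 2 * n -> p + i' < 2 * n ->
       rc r i = rc r i' -> i = i') ->
    (forall r r' i, r < p -> r' < p -> p + i < 2 * n ->
       rc r i = rc r' i -> r = r') ->
    (forall i j j', p + i < 2 * n -> p + j < 2 * n -> p + j' < 2 * n ->
       cc i j = cc i j' -> j = j') ->
    (forall r s i, r < p -> s < p -> p + i < 2 * n -> rr r s <> rc r i) ->
    (forall r i j, r < p -> p + i < 2 * n -> p + j < 2 * n ->
       ~~ ((r == x) && (i == y)) -> rc r i <> cc i j) ->
    (forall r s, r < p -> s < p -> rr r r = rr s s -> r = s) ->
    (forall i j, p + i < 2 * n -> p + j < 2 * n -> cc i i = cc j j -> i = j) ->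
    (forall r i, r < p -> p + i < 2 * n -> rr r r <> cc i i) ->
  core_spec n p x (p + y) (glue p rr rc cc).
Proof.
move=> xp pn rrC ccC rrB rcB ccB rrI rcIr rcIl ccI rr_rc rc_cc rrD ccD rr_cc.
split.
- by move=> u v; rewrite /glue; case: ifP => up; case: ifP => vp.
- move=> u v uL vL; rewrite /glue /same_pair.
  case: (ltnP u p) => up; case: (ltnP v p) => vp uv.
  + have := rrB u v up vp; lia.
  + have := rcB u (v - p) up; lia.
  + have := rcB v (u - p) vp; lia.
  + have := ccB (u - p) (v - p); lia.
- move=> u v w uL vL wL; rewrite /glue /same_pair.
  case: (ltnP u p) => up; case: (ltnP v p) => vp; case: (ltnP w p) => wp uv uw.
  + exact: rrI.
  + move/(rr_rc _ _ _ up vp); lia.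
  + move/esym/(rr_rc _ _ _ up wp); lia.
  + move/(rcIr _ _ _ up); lia.
  + move/(rcIl _ _ _ vp wp); lia.
  + move/(rc_cc _ _ _ vp); lia.
  + move/esym/(rc_cc _ _ _ wp); lia.
  + move/(ccI (u - p) (v - p) (w - p)); lia.
- move=> u v uL vL; rewrite /glue.
  case: (ltnP u p) => up; case: (ltnP v p) => vp.
  + exact: rrD.
  + move/(rr_cc _ _ up); lia.
  + move/esym/(rr_cc _ _ vp); lia.
  + move/(ccD (u - p) (v - p)); lia.
Qed.

(** Reduction modulo [m] for [s < 2 * m], in a form that [lia] can handle after case splits. *)
Definition wrap (m s : nat) : nat := if s < m then s else s - m.

(* Vertices below n and the others form two groups, both identified with Z/n.
   Each group completed by the vertex 2n is a K_{n+1} with the 1-factorization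
   by r + s, and the factor of sum 0 gets the middle colours n and 2n. *)
Definition odd_core (n : nat) : nat -> nat -> nat :=
  glue n
    (fun r s => if wrap n (r + s) == 0 then n else wrap n (r + s))
    (fun r i => if wrap n (r + i) == 0 then 2 * n else n + wrap n (r + i))
    (fun i j => if wrap n (i + j) == 0 then if i == j then 2 * n else n
                else 2 * n + wrap n (i + j)).

(** Doubling is injective modulo an odd n, so the diagonal colours differ within each group. The
    missing edge joins the two zeros: its colour would be 2n, which y gets on its edge to the vertex
    2n in place of n. *)
Lemma odd_core_spec k :
  core_spec (2 * k + 1) (2 * k + 1) 0 (2 * k + 1 + 0) (odd_core (2 * k + 1)).
Proof.
apply: glue_spec; rewrite /wrap; intros.
all: repeat match goal with
  H : context [if _ then _ else _] |- _ => revert H end.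
all: split_ifs.
all: lia.
Qed.

(* In Z/(n+1) the edges i + j = 0 and i + j = 1, with loops standing for the
   edges to the vertex 2n, form a Hamiltonian cycle 2n, 0, 1, -1, 2, -2, ..,
   n/2 + 1, 2n. [even_pos] numbers its vertices 1, -1, 2, -2, .., n/2 + 1, 0
   in this order from 0 to n. *)
Definition even_pos (n i : nat) : nat :=
  if i == 0 then n else if 2 * i <= n then 2 * i - 2 else 2 * (n + 1 - i) - 1.

(* The groups have n - 1 and n + 1 elements here. The 1-factorization of the
   K_{n+2} on the larger group and the vertex 2n has two factors too many: the
   edges of their Hamiltonian cycle get the colours n, 2n, n + 1, n + 2, ..,
   2n - 1, 2n in cyclic order. At the element of position q this uses the two
   cyclically consecutive colours n + q, n + q + 1, except that y, of position 0,
   gets 2n instead of n. The edges between the groups form the cyclic Latin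
   square on n, .., 2n without the two rows containing these colours, and its
   entry 2n at the missing edge xy makes up for the exception. *)
Definition even_core (n : nat) : nat -> nat -> nat :=
  glue n.-1
    (fun r s => (wrap n.-1 (r + s)).+1)
    (fun r i => n + wrap n.+1 (even_pos n i + 2 + r))
    (fun i j =>
      if i + j == 0 then n else if i + j == 1 then 2 * n
      else if i + j == n + 1 then n + 2 * minn i j - 1
      else if i + j == n + 2 then n + 2 * minn i j - 2
      else 2 * n - 1 + wrap n.+1 (i + j)).

(** The missing edge is at r = n - 2 and position 0, where 0 + 2 + (n - 2) = n gives the entry
    2n. *)
Lemma even_core_spec k : 0 < k ->
  core_spec (2 * k) (2 * k).-1 (2 * k - 2) ((2 * k).-1 + 1) (even_core (2 * k)).
Proof.
move=> k0; apply: glue_spec; rewrite /wrap /even_pos; intros.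
all: repeat match goal with
  H : context [if _ then _ else _] |- _ => revert H end.
all: split_ifs.
all: lia.
Qed.

(** * From colour matrices to edge-colorings *)

Definition with_apex (n : nat) (core : nat -> nat -> nat) (u v : nat) : nat :=
  core (if u == 2 * n then v else u) (if v == 2 * n then u else v).

Lemma with_apex_bound n p x y core u v :
    core_spec n p x y core -> x != y ->
    u < 2 * n -> v <= 2 * n -> ~~ same_pair x y u v ->
  (if u < p then 1 else n) + (u == y) <= with_apex n core u v <
  (if u < p then 1 else n) + 2 * n - (u == x).
Proof.
case=> _ bound _ _ xy uL vL uv; rewrite /with_apex (ltn_eqF uL).
by case: (eqVneq v (2 * n)) => [_|vz]; apply: bound => //;
  rewrite /same_pair in uv *; lia.
Qed.

Lemma with_apex_inj n p x y core u v w :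
    core_spec n p x y core -> x != y ->
    u <= 2 * n -> v <= 2 * n -> w <= 2 * n -> u != v -> u != w ->
    ~~ same_pair x y u v -> ~~ same_pair x y u w ->
  with_apex n core u v = with_apex n core u w -> v = w.
Proof.
case=> _ _ inj diag xy uL vL wL uv uw xuv xuw; rewrite /with_apex.
case: (eqVneq u (2 * n)) => [uz|uz].
  by rewrite !ifN; [apply: diag; lia | lia | lia].
have xuu : ~~ same_pair x y u u by rewrite /same_pair; lia.
case: (eqVneq v (2 * n)) => vz; case: (eqVneq w (2 * n)) => wz.
- by rewrite vz wz.
- by move/inj; lia.
- by move/inj; lia.
- by apply: inj => //; lia.
Qed.

Lemma symmetric_edge_function (V : finType) (f : V -> V -> nat) :
    (forall u v, f u v = f v u) ->
  exists alpha : {set V} -> nat, forall u v, u != v -> alpha [set u; v] = f u v.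
Proof.
(* [pick] orders the two ends arbitrarily, which is harmless by symmetry; 0 is a default value. *)
move=> fC; exists (fun e =>
  if [pick p : V * V | e == [set p.1; p.2]] is Some p then f p.1 p.2 else 0).
move=> u v uv; case: pickP => [[a b] /= /eqP uv_ab|/(_ (u, v))]; last first.
  by rewrite /= eqxx.
have: u \in [set a; b] by rewrite -uv_ab !inE eqxx.
have: v \in [set a; b] by rewrite -uv_ab !inE eqxx orbT.
rewrite !inE => /pred2P vE /pred2P uE.
by case: vE uE uv => -> [] -> //; rewrite ?eqxx // fC.
Qed.

(** Serves to carry the ends of an arbitrary deleted edge to the prescribed places x and y. *)
Lemma perm_pair (T : finType) (a b x y : T) :
  a != b -> x != y -> exists s : {perm T}, s a = x /\ s b = y.
Proof.
move=> ab xy; exists (tperm a x * tperm (tperm a x b) y)%g.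
rewrite !permM tpermL tpermL; split=> //; apply: tpermD; last by rewrite eq_sym.
by rewrite -[X in _ != X](tpermL a x) (inj_eq perm_inj) eq_sym.
Qed.

(** Pigeonhole principle, used at the ends of [e] to see that every colour occurs. *)
Lemma inj_window_onto (T : finType) (A : {set T}) (f : T -> nat) lo :
    {in A &, injective f} -> (forall a, a \in A -> lo <= f a < lo + #|A|) ->
  forall c, lo <= c < lo + #|A| -> exists2 a, a \in A & f a = c.
Proof.
move=> f_inj fA c cA.
have [|||_ /(_ c)] := @uniq_min_size _ (map f (enum A)) (iota lo #|A|).
- rewrite map_inj_in_uniq ?enum_uniq // => a b.
  by rewrite !mem_enum; apply: f_inj.
- by move=> _ /mapP[a + ->]; rewrite mem_enum mem_iota => /fA.
- by rewrite size_iota size_map cardE.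
rewrite mem_iota cA => /mapP[a]; rewrite mem_enum => aA ->.
by exists a.
Qed.

Lemma incident_del_edgeP (V : finType) (e f : {set V}) v :
    f \in incident (del_edge (complete_graph V) e) v ->
  exists2 u, u != v & f = [set v; u] /\ f != e.
Proof.
rewrite !inE => /andP[/andP[fe /cards2P[a [b [ab fE]]]]].
rewrite fE !inE -fE => /pred2P[] ->.
  by exists b; [rewrite eq_sym | split].
by exists a => //; split=> //; rewrite setUC.
Qed.

Lemma coloring_of_core n p x y core (e : {set 'I_(2 * n + 1)}) :
    0 < n -> x < p -> p <= y -> y < 2 * n -> core_spec n p x y core ->
    e \in edges (complete_graph 'I_(2 * n + 1)) ->
  let G := del_edge (complete_graph 'I_(2 * n + 1)) e in
  exists2 alpha, proper_edge_coloring G (3 * n - 1) alpha &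
    coloring_def G alpha <= n - 1.
Proof.
move=> n0 xp py yL core_ok eK G.
have [coreC _ _ _] := core_ok.
have xy : x != y by lia.
have xL1 : x < 2 * n + 1 by lia.
have yL1 : y < 2 * n + 1 by lia.
have zL1 : 2 * n < 2 * n + 1 by lia.
move: (eK); rewrite inE => /cards2P[a [b [ab eE]]].
have [s [sa sb]] := @perm_pair _ a b (Ordinal xL1) (Ordinal yL1) ab xy.
have [alpha alphaE] : exists alpha : {set 'I_(2 * n + 1)} -> nat,
    forall u v, u != v -> alpha [set u; v] = with_apex n core (s u) (s v).
  apply: symmetric_edge_function => u v.
  rewrite /with_apex coreC.
  by case: eqP => [->|]; case: eqP => // ->.
have sL v : s v <= 2 * n by have := ltn_ord (s v); lia.
have s_neq u v : u != v -> s u != s v :> nat.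
  by rewrite (inj_eq val_inj) (inj_eq perm_inj).
have eqE v : ((s v == x :> nat) = (v == a)) * ((s v == y :> nat) = (v == b)).
  split; [rewrite -[x]/(val (Ordinal xL1)) -sa
         | rewrite -[y]/(val (Ordinal yL1)) -sb];
    by rewrite (inj_eq val_inj) (inj_eq perm_inj).
have same_pairE u v : same_pair x y (s u) (s v) = ([set u; v] == e).
  rewrite /same_pair !eqE eE; apply/idP/eqP.
    by case/orP=> /andP[/eqP-> /eqP->] //; rewrite setUC.
  move=> uv; have : a \in [set u; v] by rewrite uv set21.
  have : b \in [set u; v] by rewrite uv set22.
  rewrite !inE => /pred2P bE /pred2P aE.
  by case: bE aE ab => -> [] ->; rewrite ?eqxx ?orbT.
have bound v f : f \in incident G v -> s v < 2 * n ->
    (if s v < p then 1 else n) + (s v == y :> nat) <= alpha f <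
    (if s v < p then 1 else n) + 2 * n - (s v == x :> nat).
  move=> /incident_del_edgeP[u uv [-> ue]] vL; rewrite alphaE ?(eq_sym v) //.
  by apply: (with_apex_bound core_ok) => //; rewrite same_pairE.
have alpha_inj v : {in incident G v &, injective alpha}.
  move=> f g /incident_del_edgeP[u uv [-> ue]].
  move=> /incident_del_edgeP[w wv [-> we]].
  rewrite !alphaE ?(eq_sym v) // => /(with_apex_inj core_ok xy).
  rewrite !same_pairE.
  rewrite !sL !s_neq ?(eq_sym v) // => /(_ isT isT isT isT isT ue we).
  by move/val_inj/perm_inj->.
have incE f v : (f \in incident G v) = (f \in edges G) && (v \in f).
  by rewrite inE.
have range f : f \in edges G -> 1 <= alpha f <= 3 * n - 1.
  move=> fG; have /eqP/cards2P[u [v [uv fE]]] : #|f| = 2.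
    exact/eqP/(forall_inP (edges_card2 G)).
  have fu : f \in incident G u by rewrite incE fG fE set21.
  have fv : f \in incident G v by rewrite incE fG fE set22.
  have su := s_neq _ _ uv; have uL := sL u; have vL := sL v.
  (* At most one end is the exceptional vertex, so [bound] applies at the other. *)
  have [/(bound _ _ fu)|/(bound _ _ fv)] : s u < 2 * n \/ s v < 2 * n by lia.
    by case: ifP; lia.
  by case: ifP; lia.
have degG v : #|incident G v| = 2 * n - (v \in e).
  by rewrite (card_incident_del_edge v eK) card_ord; congr subn; lia.
have onto v lo : lo + #|incident G v| = lo + 2 * n - 1 ->
    (forall f, f \in incident G v -> lo <= alpha f < lo + 2 * n - 1) ->
    forall c, lo <= c < lo + 2 * n - 1 ->
    exists2 f, f \in edges G & alpha f = c.
  move=> degv fv c; rewrite -degv => clo.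
  rewrite -degv in fv; have [f fG <-] := inj_window_onto (alpha_inj v) fv clo.
  by exists f => //; move: fG; rewrite incE => /andP[].
have proper : proper_edge_coloring G (3 * n - 1) alpha.
  split=> // [c cn|f g fG gG fg].
    (* The spectrum of [b] is [n + 1, 3n - 1] and that of [a] is [1, 2n - 1]. *)
    case: (leqP n.+1 c) => nc.
      apply: (onto b n.+1) => [|f fb|]; last by lia.
        by rewrite degG eE set22; lia.
      by have := bound b f fb; rewrite sb /=; case: ifP; lia.
    apply: (onto a 1) => [|f fa|]; last by lia.
      by rewrite degG eE set21; lia.
    by have := bound a f fa; rewrite sa /=; case: ifP; lia.
  case/pred0Pn=> v /andP[/= vf vg]; apply: contra fg => /eqP fg; apply/eqP.
  by apply: (alpha_inj v); rewrite ?incE ?fG ?gG.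
exists alpha => //.
have spec0 v : spectrum G alpha v != fset0.
  by apply: spectrum_neq0; rewrite degG; case: (v \in e); lia.
have degE v : #|incident G v| = 2 * n - (s v == x :> nat) - (s v == y :> nat).
  rewrite degG eE !inE -!eqE; lia.
pose z := (s^-1 (Ordinal zL1))%g.
have sz : s z = 2 * n :> nat by rewrite permKV.
(* At [z], 2n colours lie among 3n - 1, which gives n - 1; every other spectrum fills its window. *)
rewrite /coloring_def (bigD1 z) //= big1 ?addn0 => [|v vz].
  apply: leq_trans (set_def_leq (lo := 1) (hi := 3 * n - 1) _ _) _ => //.
    by move=> _ /imfsetP[f /= + ->]; rewrite inE => /andP[/range].
  rewrite (card_spectrum _ proper) degE sz; lia.
have vL : s v < 2 * n by have := s_neq _ _ vz; have := sL v; lia.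
apply/eqP; rewrite -leqn0; pose lo := if s v < p then 1 else n.
apply: leq_trans (set_def_leq (lo := lo + (s v == y :> nat))
  (hi := lo + 2 * n - (s v == x :> nat) - 1) _ _) _ => //.
  move=> _ /imfsetP[f /= fv ->]; have := bound _ _ fv vL; rewrite -/lo; lia.
rewrite (card_spectrum _ proper) degE.
have : 0 < lo by rewrite /lo; case: ifP.
lia.
Qed.

Lemma exists_coloring n (e : {set 'I_(2 * n + 1)}) :
    0 < n -> e \in edges (complete_graph 'I_(2 * n + 1)) ->
  let G := del_edge (complete_graph 'I_(2 * n + 1)) e in
  exists2 alpha, proper_edge_coloring G (3 * n - 1) alpha &
    coloring_def G alpha <= n - 1.
Proof.
move=> n0 eK; case: (boolP (odd n)) => n_odd.
  have nE : n = 2 * n./2 + 1 by rewrite -{1}(odd_double_half n) n_odd; lia.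
  have := odd_core_spec n./2; rewrite -nE => core_ok.
  by apply: coloring_of_core core_ok eK; lia.
have nE : n = 2 * n./2 by rewrite -{1}(odd_double_half n) (negPf n_odd); lia.
have := @even_core_spec n./2; rewrite -nE => core_ok.
by apply: coloring_of_core (core_ok _) eK; lia.
Qed.

Theorem theorem3p3 (n : nat) (n_gt0 : 0 < n) (e : {set 'I_(2 * n + 1)})
    (eK : e \in edges (complete_graph 'I_(2 * n + 1))) :
  w_def (del_edge (complete_graph 'I_(2 * n + 1)) e) = 3 * n - 1.
Proof.
have cardV : #|'I_(2 * n + 1)| = 2 * n + 1 by rewrite card_ord.
have lower t alpha := @coloring_def_del_edge_geq _ e n t alpha n_gt0 cardV eK.
have [alpha proper def_alpha] := exists_coloring n_gt0 eK.
have defE : graph_def (del_edge (complete_graph 'I_(2 * n + 1)) e) = n - 1.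
  rewrite /graph_def; case: ex_minnP => d /asboolP[t [beta [/lower[dn _] <-]]].
  move=> d_min; apply/eqP; rewrite eqn_leq dn andbT.
  apply: leq_trans def_alpha; apply: d_min.
  by apply/asboolP; exists (3 * n - 1), alpha.
(* For deficiency n - 1, the bound 4n - 2 on the sum of t and the deficiency becomes t >= 3n - 1. *)
rewrite /w_def; case: ex_minnP => t.
move=> /asboolP[beta [/lower[_ tn] def_beta]] t_min.
apply/eqP; rewrite eqn_leq t_min; first by lia.
apply/asboolP; exists alpha; split=> //.
by apply/eqP; rewrite eqn_leq defE def_alpha; have [] := lower _ _ proper.
Qed.
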